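(* There is an absolute constant $C>0$ such that the following holds. Let $p(x_1,\dots,x_n)$ be a read-$\Delta$ $\mathbb{F}_2$-polynomial of degree $d$. Then for every $1\le k\le n$, \[ L_{1,k}(p)\;\le\;\Pr_{x\sim\{0,1\}^n}[p(x)=1]\cdot (Ck)^k\cdot (\Delta d)^{8k}. \]
   Context: An $\mathbb{F}_2$-polynomial (written as a sum of distinct multilinear monomials) is read-$\Delta$ if each input variable appears in at most $\Delta$ of its monomials. For $p\colon\{0,1\}^n\to\{0,1\}$ and $S\subseteq[n]$, $\hat p(S)=\mathbb{E}_{x}[p(x)(-1)^{\sum_{i\in S}x_i}]$ for uniform $x\in\{0,1\}^n$, and $L_{1,k}(p)=\sum_{|S|=k}|\hat p(S)|$. *)

(* Defs.v *)
From HB Require Import structures.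
From mathcomp Require Import all_boot all_order all_algebra.
From mathcomp Require Export reals.
From mathcomp.multinomials Require Export mpoly.
Set Implicit Arguments.
Unset Strict Implicit.
Unset Printing Implicit Defensive.
Import Order.TTheory GRing.Theory Num.Theory.
Local Open Scope ring_scope.

Definition cube (n : nat) := {ffun 'I_n -> bool}.

Definition multilinear n (p : {mpoly 'F_2[n]}) : Prop :=
  forall m : 'X_{1..n}, m \in msupp p -> forall i : 'I_n, (m i <= 1)%N.

(* [msupp p] is duplicate-free, so this counts distinct monomials. *)
Definition read_le n (Delta : nat) (p : {mpoly 'F_2[n]}) : Prop :=
  forall i : 'I_n,
    (count (fun m : 'X_{1..n} => m i != 0%N) (msupp p) <= Delta)%N.

(* [msize] is the degree plus one, and [0] for the zero polynomial, whose
   degree is taken to be [0] here. *)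
Definition degree n (p : {mpoly 'F_2[n]}) : nat := (msize p).-1.

Definition boolfun n (p : {mpoly 'F_2[n]}) (x : cube n) : bool :=
  p.@[fun i => (x i)%:R] == 1.

Definition expect (R : realType) n (f : cube n -> R) : R :=
  (\sum_(x : cube n) f x) / #|{: cube n}|%:R.

Definition prob (R : realType) n (E : pred (cube n)) : R :=
  #|[set x : cube n | E x]|%:R / #|{: cube n}|%:R.

Definition fourier (R : realType) n (f : cube n -> bool) (S : {set 'I_n}) : R :=
  expect (fun x => (f x)%:R * (-1) ^+ (\sum_(i in S) x i)%N).

Definition L1 (R : realType) n (k : nat) (f : cube n -> bool) : R :=
  \sum_(S : {set 'I_n} | #|S| == k) `|fourier R f S|.

(* Main.v *)
Require Import Defs.
From mathcomp Require Import all_boot all_order all_algebra.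
From mathcomp Require Import ring lra.
Set Implicit Arguments.
Unset Strict Implicit.
Unset Printing Implicit Defensive.
Import Order.TTheory GRing.Theory Num.Theory.
Local Open Scope ring_scope.

(** Put [D = Delta * d] and [f = (-1)^p], let [w_i] be the probability that
    flipping [x_i] changes [p], and let [W] be the sum of the [w_i].  Fix [S]
    with [k] elements and a set [J] of variables whose neighbourhoods are
    disjoint from each other and from that of [S].  A sign-reversing involution
    on the directions in [S] and [J] kills the contribution to the Fourier
    coefficient of [f] at [S] of every point where some [j] in [J] is
    influential, or where some [i] in [S] lies in no monomial whose variables
    outside [S] are all set.  By independence the coefficient is at most
    [Pr (alive S) * \prod_(j in J) (1 - w_j)], and a greedy choice gives
    [W <= D^2 * (\sum_(j in J) w_j + k)].

    Summed over [S], the probabilities [Pr (alive S)] are at most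
    [(2d)^k V (V + kD)^(k-1)], with [V] the sum of [2^-|A|] over the nonempty
    monomials [A].  A polynomial with [s] monomials, one of which has size [b],
    equals [1] with probability at least [2^-b / s]; applied to derivatives this
    gives [V <= Delta^2 W], so the decay in [W] beats the growth in [V].  The
    factor [Pr (p = 1)] comes from the case [S = set0], which bounds
    [1 - 2 Pr (p = 1)] by the same product. *)

(** * Uniform random subsets: expectation, independence, sign-reversing involutions *)

Section UniformSubset.
Variables (R : realFieldType) (T : finType).
Implicit Types (X Y U V A S : {set T}) (P Q : pred {set T}) (g : {set T} -> R).

Definition Ex g : R := (\sum_X g X) / 2 ^+ #|T|.
Definition Pr P : R := Ex (fun X => (P X)%:R).

Let pow2_gt0 : 0 < 2 ^+ #|T| :> R.
Proof. by rewrite exprn_gt0. Qed.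

Let card_subsets : #|{: {set T}}| = (2 ^ #|T|)%N.
Proof. by rewrite -(cardsT {set T}) -powersetT card_powerset cardsT. Qed.

Lemma eq_Ex g1 g2 : g1 =1 g2 -> Ex g1 = Ex g2.
Proof. by move=> e; congr (_ / _); apply: eq_bigr => X _. Qed.

Lemma eq_Pr P Q : P =1 Q -> Pr P = Pr Q.
Proof. by move=> e; apply: eq_Ex => X; rewrite e. Qed.

Lemma le_Ex g1 g2 : (forall X, g1 X <= g2 X) -> Ex g1 <= Ex g2.
Proof. by move=> e; rewrite ler_pM2r ?invr_gt0 //; apply: ler_sum. Qed.

Lemma ExD g1 g2 : Ex (fun X => g1 X + g2 X) = Ex g1 + Ex g2.
Proof. by rewrite /Ex big_split mulrDl. Qed.

Lemma ExZ (c : R) g : Ex (fun X => c * g X) = c * Ex g.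
Proof. by rewrite /Ex -mulr_sumr mulrA. Qed.

Lemma Ex_const (c : R) : Ex (fun=> c) = c.
Proof.
rewrite /Ex sumr_const card_subsets -(mulr_natr c).
by rewrite natrX mulfK // gt_eqF.
Qed.

Lemma le_Pr P Q : (forall X, P X -> Q X) -> Pr P <= Pr Q.
Proof.
move=> PQ; apply: le_Ex => X; rewrite ler_nat.
by case: (P X) (PQ X) => // ->.
Qed.

Lemma Pr_ge0 P : 0 <= Pr P.
Proof. by apply: divr_ge0; [apply: sumr_ge0 | exact: ltW]. Qed.

Lemma PrC P : Pr (fun X => ~~ P X) = 1 - Pr P.
Proof.
apply/eqP; rewrite eq_sym subr_eq -ExD -[X in X == _]Ex_const; apply/eqP.
by apply: eq_Ex => X; case: (P X); rewrite ?addr0 ?add0r.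
Qed.

Lemma Pr_le1 P : Pr P <= 1.
Proof. by rewrite -subr_ge0 -PrC Pr_ge0. Qed.

Lemma Pr_subset A : Pr (fun X => A \subset X) = 2 ^- #|A|.
Proof.
rewrite /Pr /Ex -natr_sum.
have -> : (\sum_(X : {set T}) (A \subset X) = #|[set X : {set T} | A \subset X]|)%N.
  by rewrite -sum1dep_card [RHS]big_mkcond; apply: eq_bigr => X _; case: ifP.
have -> : [set X : {set T} | A \subset X] = (@setC T) @: powerset (~: A).
  apply/setP => X; rewrite inE; apply/idP/imsetP => [sAX|[Y]].
    by exists (~: X); rewrite ?setCK // powersetE setCS.
  by rewrite powersetE => sY ->; rewrite -(setCK A) setCS.
rewrite card_imset; last exact: can_inj (@setCK T).
rewrite card_powerset natrX -(cardsC A) exprD invfM mulrCA divff ?mulr1 //.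
by rewrite expf_neq0 // pnatr_eq0.
Qed.

Lemma Pr_exists_le (I : finType) (B : pred I) (P : I -> pred {set T}) :
  Pr (fun X => [exists i in B, P i X]) <= \sum_(i in B) Pr (P i).
Proof.
rewrite /Pr /Ex -mulr_suml ler_pM2r ?invr_gt0 // exchange_big /=.
apply: ler_sum => X _; case: existsP => [[i /andP[iB PiX]]|_]; last first.
  by apply: sumr_ge0 => i _.
by rewrite (bigD1 i) //= PiX lerDl sumr_ge0.
Qed.

Definition depends_on U P :=
  forall X Y, X :&: U = Y :&: U -> P X = P Y.

Lemma depends_onS U V P : U \subset V -> depends_on U P -> depends_on V P.
Proof.
move=> sUV dP X Y eXY; apply: dP.
by rewrite -(setIidPr sUV) !setIA eXY.
Qed.

(* Exchanging the [U]-parts of two independent samples is measure preserving. *)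
Lemma Pr_indep U V P Q :
    depends_on U P -> depends_on V Q -> [disjoint U & V] ->
  Pr (fun X => P X && Q X) = Pr P * Pr Q.
Proof.
move=> dP dQ dUV.
pose mix X Y := (X :&: U) :|: (Y :\: U).
have PmixE X Y : P (mix X Y) = P X.
  apply: dP; apply/setP => x; rewrite !inE.
  by case: (x \in U); rewrite !(andbT, andbF, orbF).
have QmixE X Y : Q (mix X Y) = Q Y.
  apply: dQ; apply/setP => x; rewrite !inE.
  case: (boolP (x \in V)) => xV; last by rewrite !andbF.
  by rewrite (disjointFl dUV xV) /= andbF.
pose h (p : {set T} * {set T}) := (mix p.1 p.2, mix p.2 p.1).
have hK : involutive h.
  case=> X Y; rewrite /h /mix /=; congr pair; apply/setP => x; rewrite !inE;
    by case: (x \in U); rewrite !(andbT, andbF, orbF).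
have e : (\sum_X (P X)%:R) * (\sum_Y (Q Y)%:R)
       = (\sum_X (P X && Q X)%:R) * 2 ^+ #|T| :> R.
  rewrite big_distrlr /= pair_big /= (reindex_inj (inv_inj hK)) /=.
  under eq_bigr => p _ do rewrite PmixE QmixE.
  rewrite -(pair_big xpredT xpredT (fun X Y => (P X)%:R * (Q X)%:R)) /=.
  rewrite mulr_suml; apply: eq_bigr => X _.
  rewrite sumr_const card_subsets -[LHS]mulr_natr natrX.
  by rewrite -natrM mulnb.
rewrite /Pr /Ex mulrACA e -!mulrA; congr (_ * _).
by rewrite mulrA divff ?mul1r // gt_eqF.
Qed.

(** The events are split off one at a time: each [Q j] is absorbed into [P], and [N j] into [U],
    before the next one. *)
Lemma Pr_indep_all (N : T -> {set T}) U P (Q : T -> pred {set T}) (J : seq T) :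
    depends_on U P -> (forall j, depends_on (N j) (Q j)) ->
    (forall j, j \in J -> [disjoint U & N j]) ->
    uniq J -> {in J &, forall i j, i != j -> [disjoint N i & N j]} ->
  Pr (fun X => P X && all (fun j => Q j X) J) = Pr P * \prod_(j <- J) Pr (Q j).
Proof.
move=> dP dQ; elim: J U P dP => [|j J IH] U P dP dU.
  by rewrite big_nil mulr1 => _ _; apply: eq_Pr => X; rewrite andbT.
move=> /= /andP[jJ uJ] dN.
rewrite big_cons mulrA -(Pr_indep dP (dQ j)); last exact: dU (mem_head _ _).
rewrite -(IH (U :|: N j)) //.
- by apply: eq_Pr => X /=; rewrite andbA.
- move=> X Y e; congr (_ && _).
    exact: depends_onS (subsetUl _ _) dP _ _ e.
  exact: depends_onS (subsetUr _ _) (dQ j) _ _ e.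
- move=> i iJ; rewrite -setI_eq0 setIUl setU_eq0 !setI_eq0.
  rewrite dU ?inE ?iJ ?orbT //= dN ?inE ?eqxx ?iJ ?orbT //.
  by apply: contraNneq jJ => ->.
- by move=> a b aJ bJ; apply: dN; rewrite inE ?aJ ?bJ orbT.
Qed.

Definition flip i X := [set x | (x \in X) (+) (x == i)].

Lemma in_flip i X x : (x \in flip i X) = (x \in X) (+) (x == i).
Proof. by rewrite inE. Qed.

Lemma flipK i : involutive (flip i).
Proof. by move=> X; apply/setP => x; rewrite !inE -addbA addbb addbF. Qed.

Lemma subset_flip i X A : i \notin A -> (A \subset flip i X) = (A \subset X).
Proof.
move=> iA; apply/subsetP/subsetP => s x xA; move: (s x xA); rewrite in_flip;
  by rewrite (negPf (memPn iA x xA)) addbF.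
Qed.

(** Flip the first [i] in [U] with [P i X]. Flips in [U] preserve all the events [P i], so the same
    index is selected afterwards: this is an involution negating [g] wherever an index is selected.
    Those points cancel, and every other point contributes at most 1. *)
Lemma sign_reversing g U (P : T -> pred {set T}) :
    (forall X, `|g X| <= 1) ->
    (forall i j X, i \in U -> j \in U -> P i (flip j X) = P i X) ->
    (forall i X, i \in U -> P i X -> g (flip i X) = - g X) ->
  `|Ex g| <= Pr (fun X => [forall i in U, ~~ P i X]).
Proof.
move=> g1 Pinv gN.
pose pk X := [pick i in U | P i X].
pose phi X := if pk X is Some i then flip i X else X.
have pkU X i : pk X = Some i -> (i \in U) && P i X.
  by rewrite /pk; case: pickP => // j h [<-].
have pk_phi X : pk (phi X) = pk X.
  rewrite {1}/pk /phi; case E: (pk X) => [i|]; last by rewrite -E.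
  rewrite -E; apply: eq_pick => j /=.
  by case: (boolP (j \in U)) => //= jU; apply: Pinv => //; case/andP: (pkU _ _ E).
have phiK : involutive phi.
  move=> X; rewrite {1}/phi pk_phi /phi; case: (pk X) => // i.
  exact: flipK.
have pkN X : (pk X == None) = [forall i in U, ~~ P i X].
  rewrite /pk; case: pickP => [i /andP[iU Pi]|no].
    by apply/esym/negbTE/forall_inPn; exists i => //; rewrite negbK.
  by apply/esym/forall_inP => i iU; move: (no i); rewrite /= iU /= => ->.
have bad0 : \sum_(X | pk X != None) g X = 0.
  have : \sum_(X | pk X != None) g X = - \sum_(X | pk X != None) g X.
    rewrite {1}(reindex_inj (inv_inj phiK)) /= -sumrN.
    apply: eq_big => [X|X]; rewrite pk_phi // /phi.
    case E: (pk X) => [i|] // _; case/andP: (pkU _ _ E) => iU Pi.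
    exact: gN.
  by move/eqP; rewrite -addr_eq0 -mulr2n mulrn_eq0 => /eqP.
rewrite /Ex (bigID (fun X => pk X == None)) /= bad0 addr0.
rewrite normrM normfV (ger0_norm (ltW pow2_gt0)) ler_pM2r ?invr_gt0 //.
apply: (le_trans (ler_norm_sum _ _ _)).
rewrite big_mkcond /=; apply: ler_sum => X _; rewrite pkN.
by case: ifP.
Qed.
End UniformSubset.

(** * Polynomials over ['F_2] as set families: derivatives, restrictions, and a lower bound on the
    density of ones *)

Section Parity.
Variables (R : realFieldType) (T : finType).
Implicit Types (X A B : {set T}) (F G : {set {set T}}) (i : T).

(* [F] is the set of monomials of a polynomial over 'F_2, [parity F X] its
   value at the indicator of [X]. *)
Definition parity F X : bool := \big[addb/false]_(A in F) (A \subset X).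

(** The derivative of the polynomial in direction [i]; its value tells whether flipping [i] changes
    the parity. *)
Definition dparity F i X : bool :=
  \big[addb/false]_(A in F | i \in A) (A :\ i \subset X).

Lemma parity_flip F i X : parity F (flip i X) = parity F X (+) dparity F i X.
Proof.
rewrite /parity /dparity [X in _ = _ (+) X]big_mkcondr -big_split /=.
apply: eq_bigr => A _; case: ifPn => iA; last by rewrite subset_flip ?addbF.
have subE (Y : {set T}) : (A \subset Y) = (i \in Y) && (A :\ i \subset Y).
  by rewrite -[in LHS](setD1K iA) subUset sub1set.
rewrite !subE subset_flip ?setD11 // in_flip eqxx.
by case: (i \in X); case: (_ \subset _).
Qed.

(** The polynomial is p0 + x_i p1 with p0, p1 free of x_i; these are [constpart] and [linpart]. As
    [symdiff] is addition over ['F_2], the restriction to x_i = 1 is [symdiff] of the two. *)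
Definition constpart G i := [set A in G | i \notin A].
Definition linpart G i := [set A :\ i | A in G & i \in A].
Definition symdiff F G := [set A | (A \in F) (+) (A \in G)].

Let setD1_inj i : {in [pred A : {set T} | i \in A] &, injective (fun A => A :\ i)}.
Proof. by move=> A B /= iA iB e; rewrite -(setD1K iA) -(setD1K iB) e. Qed.

Lemma parity_linpart G i X : parity (linpart G i) X = dparity G i X.
Proof.
rewrite /parity /linpart big_imset /=; first by apply: eq_bigl => A; rewrite inE.
by move=> A B; rewrite !inE => /andP[_ iA] /andP[_ iB]; apply: setD1_inj.
Qed.

Lemma card_linpart G i : #|linpart G i| = #|[set A in G | i \in A]|.
Proof.
rewrite card_in_imset; first by apply: eq_card => A; rewrite !inE.
by move=> A B; rewrite !inE => /andP[_ iA] /andP[_ iB]; apply: setD1_inj.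
Qed.

Lemma card_parts G i : (#|constpart G i| + #|linpart G i|)%N = #|G|.
Proof.
rewrite card_linpart addnC -(cardsID [set A : {set T} | i \in A] G); congr addn.
  by apply: eq_card => A; rewrite !inE.
by apply: eq_card => A; rewrite !inE andbC.
Qed.

Lemma parity_symdiff F G X : parity (symdiff F G) X = parity F X (+) parity G X.
Proof.
rewrite /parity !(big_mkcond (fun A => A \in _)) -big_split /=.
apply: eq_bigr => A _; rewrite inE.
by case: (A \in F); case: (A \in G); case: (_ \subset _).
Qed.

Lemma card_symdiff F G : (#|symdiff F G| <= #|F| + #|G|)%N.
Proof.
apply: leq_trans (leq_card_setU F G); apply: subset_leq_card.
by apply/subsetP => A; rewrite !inE; case: (A \in F); case: (A \in G).
Qed.

Lemma constpart_flip G i X : parity (constpart G i) (flip i X) = parity (constpart G i) X.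
Proof.
by apply: eq_bigr => A; rewrite inE => /andP[_ iA]; rewrite subset_flip.
Qed.

Lemma linpart_flip G i X : parity (linpart G i) (flip i X) = parity (linpart G i) X.
Proof.
apply: eq_bigr => A /imsetP[B _ ->]; by rewrite subset_flip // setD11.
Qed.

Lemma parity_parts G i X :
  parity G X = parity (constpart G i) X (+) ((i \in X) && parity (linpart G i) X).
Proof.
have p0 (Y : {set T}) : i \notin Y -> parity G Y = parity (constpart G i) Y.
  move=> iY; rewrite /parity (bigID (fun A : {set T} => i \in A)) /= big1 => [|A].
    by apply: eq_bigl => A; rewrite inE.
  by case/andP=> _ iA; apply: contraNF iY => /subsetP; apply.
case: (boolP (i \in X)) => iX; last by rewrite p0 // addbF.
rewrite -(flipK i X) parity_flip p0; last by rewrite in_flip eqxx addbT iX.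
by rewrite -parity_linpart flipK constpart_flip linpart_flip.
Qed.

(** Pairing [X] with [flip i X] averages the restrictions to x_i = 0 and x_i = 1. *)
Lemma Pr_parity_split G i :
  Pr R (parity G) =
    (Pr R (parity (constpart G i)) + Pr R (parity (symdiff (constpart G i) (linpart G i)))) / 2.
Proof.
rewrite -ExD; apply: (mulIf (x := 2)); first by rewrite pnatr_eq0.
rewrite divfK ?pnatr_eq0 // mulr_natr mulr2n.
have -> : Pr R (parity G) + Pr R (parity G)
    = Pr R (parity G) + Pr R (fun X => parity G (flip i X)).
  congr (_ + _); congr (_ / _).
  by rewrite (reindex_inj (inv_inj (flipK i))).
rewrite -ExD; apply: eq_Ex => X.
rewrite parity_symdiff !(parity_parts G i) constpart_flip linpart_flip in_flip eqxx.
case: (i \in X); case: (parity (constpart _ _) _); case: (parity (linpart _ _) _);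
  by rewrite //= ?addr0 ?add0r.
Qed.

(* An uncertainty principle for the Moebius transform over 'F_2.  Splitting off
   a variable outside [B], the smaller of the two parts suffices if it contains
   [B]; otherwise [B] survives in both restrictions of the polynomial. *)
Lemma Pr_parity_ge G B : B \in G -> 1 <= 2 ^+ #|B| * #|G|%:R * Pr R (parity G).
Proof.
(* Induction on the number of variables that occur; both parts and their sum avoid the variable
   split off. *)
move: {2}#|cover G| (leqnn #|cover G|) => n.
elim: n G B => [|n IH] G B.
  rewrite leqn0 cards_eq0 => /eqP cG BG.
  have G0 A : A \in G -> A = set0.
    by move=> AG; apply/eqP; rewrite -subset0 -cG; apply: bigcup_sup.
  have -> : G = [set set0].
    apply/setP => A; rewrite inE; apply/idP/eqP => [/G0 //|->].
    by rewrite -(G0 B BG).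
  rewrite (G0 B BG) cards0 cards1 !mul1r.
  rewrite (@eq_Pr _ _ _ (fun X => ~~ false)) ?PrC.
    by rewrite /Pr Ex_const subr0.
  by move=> X; rewrite /parity big_set1 sub0set.
move=> cn BG.
have [c0|[i ic]] := set_0Vmem (cover G).
  by apply: IH => //; rewrite c0 cards0.
have cov G' : (forall A, A \in G' -> A \subset cover G :\ i) ->
    (#|cover G'| <= n)%N.
  move=> h; rewrite -ltnS; apply: leq_trans cn.
  rewrite [in X in (_ < X)%N](cardsD1 i) ic add1n ltnS; apply: subset_leq_card.
  by apply/bigcupsP.
have h0 A : A \in constpart G i -> A \subset cover G :\ i.
  by rewrite inE => /andP[AG iA]; rewrite subsetD1 iA andbT; apply: bigcup_sup.
have h1 A : A \in linpart G i -> A \subset cover G :\ i.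
  move=> /imsetP[A']; rewrite inE => /andP[A'G iA'] ->.
  by apply: setSD; apply: bigcup_sup.
have h2 A : A \in symdiff (constpart G i) (linpart G i) -> A \subset cover G :\ i.
  by rewrite inE; case: (boolP (A \in constpart G i)) => [/h0 //|_ /= /h1].
have IH0 C := IH _ C (cov _ h0).
have IH1 C := IH _ C (cov _ h1).
have IH2 C := IH _ C (cov _ h2).
have := Pr_parity_split G i.
have := card_symdiff (constpart G i) (linpart G i).
have := card_parts G i.
(* Since p1 is the sum of p0 and p0 + p1, one of these is 1 wherever p1 is. *)
have le1 : Pr R (parity (linpart G i)) <= Pr R (parity (constpart G i))
    + Pr R (parity (symdiff (constpart G i) (linpart G i))).
  rewrite -ExD; apply: le_Ex => X; rewrite parity_symdiff.
  by case: (parity (constpart _ _) _); case: (parity (linpart _ _) _);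
    rewrite /= -natrD ler_nat.
have q0 := Pr_ge0 R (parity (constpart G i)).
have q1 := Pr_ge0 R (parity (linpart G i)).
have q2 := Pr_ge0 R (parity (symdiff (constpart G i) (linpart G i))).
move: le1 q0 q1 q2 IH0 IH1 IH2.
set r0 := Pr R (parity (constpart G i)); set r1 := Pr R (parity (linpart G i)).
set r2 := Pr R (parity (symdiff _ _)).
move=> le1 q0 q1 q2 IH0 IH1 IH2 cE csd ->; rewrite -cE natrD.
(* If [i] is in [B], then [B :\ i] is a monomial of the linear part, and the factor 2 lost from
   [2 ^+ #|B|] pays for the halving in the average. *)
case: (boolP (i \in B)) => iB.
  have /IH1 : B :\ i \in linpart G i by apply: imset_f; rewrite inE BG.
  rewrite [in X in _ -> X](cardsD1 i) iB add1n exprS.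
  set a := 2 ^+ _ => h; apply: (le_trans h).
  have a0 : 0 <= a by rewrite exprn_ge0.
  have -> : 2 * a * (#|constpart G i|%:R + #|linpart G i|%:R) * ((r0 + r2) / 2)
     = a * #|linpart G i|%:R * (r0 + r2) + a * #|constpart G i|%:R * (r0 + r2) by field.
  rewrite -[X in X <= _]addr0; apply: lerD.
    by apply: ler_wpM2l => //; rewrite mulr_ge0.
  by rewrite !mulr_ge0 // addr_ge0.
have B0 : B \in constpart G i by rewrite inE BG.
have := IH0 _ B0; set a := 2 ^+ _.
have a0 : 0 <= a by rewrite exprn_ge0.
have [s01|s10] := leqP #|constpart G i| #|linpart G i|.
  move=> h; apply: (le_trans h); rewrite -!mulrA; apply: ler_wpM2l => //.
  rewrite -(ler_nat R) in s01; set x := _%:R in s01 *; set y := _%:R in s01 *.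
  have x0 : 0 <= x by rewrite ler0n.
  nra.
move=> h0'.
case: (boolP (B \in linpart G i)) => B1.
  have := IH1 _ B1; rewrite -/a => h; apply: (le_trans h).
  rewrite -!mulrA; apply: ler_wpM2l => //.
  move/ltnW: s10; rewrite -(ler_nat R); set x := _%:R; set y := _%:R => s10.
  have x0 : 0 <= x by rewrite ler0n.
  nra.
have B2 : B \in symdiff (constpart G i) (linpart G i) by rewrite inE B0 (negPf B1).
have := IH2 _ B2; rewrite -/a => h2'.
move: csd; rewrite -(ler_nat R) natrD.
move: h0' h2'; rewrite -!mulrA.
set x := #|constpart G i|%:R; set y := #|linpart G i|%:R; set z := #|_|%:R => e0 e2 e3.
have y0 : 0 <= y by rewrite ler0n.
have x0 : 0 <= x by rewrite ler0n.
have e0' : 1 <= a * ((x + y) * r0).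
  by apply: (le_trans e0); apply: ler_wpM2l => //; apply: ler_wpM2r => //; lra.
have e2' : 1 <= a * ((x + y) * r2).
  by apply: (le_trans e2); apply: ler_wpM2l => //; apply: ler_wpM2r.
lra.
Qed.

End Parity.

(** * Counting tools: greedy sparse subfamilies and sums over tuples *)

Lemma card_bigcup_le (I T : finType) (P : pred I) (B : I -> {set T}) m :
    (forall i, P i -> (#|B i| <= m)%N) ->
  (#|\bigcup_(i | P i) B i| <= #|[set i | P i]| * m)%N.
Proof.
move=> Bm; rewrite -sum_nat_const.
rewrite (eq_bigl P) => [|i]; last by rewrite inE.
apply: (@leq_trans (\sum_(i | P i) #|B i|)); last exact: leq_sum.
elim/big_rec2: _ => [|i m' U _ le]; first by rewrite cards0.
by apply: leq_trans (leq_card_setU _ _) _; rewrite leq_add2l.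
Qed.

(** Greedy choice: take the heaviest remaining element and discard everything near it, at most [m]
    elements, none of them heavier. *)
Lemma sparse_subfamily (R : realFieldType) (T : finType) (near : T -> {set T})
    (m : nat) (w : T -> R) (A : {set T}) :
    (forall i, i \in near i) -> (forall i j, (j \in near i) = (i \in near j)) ->
    (forall i, (#|near i| <= m)%N) -> (forall i, 0 <= w i) ->
  exists J : seq T, [/\ uniq J, {subset J <= A},
    {in J &, forall i j, i != j -> j \notin near i} &
    \sum_(i in A) w i <= m%:R * \sum_(i <- J) w i].
Proof.
move=> nrefl nsym nm w0.
move: {2}#|A| (leqnn #|A|) => n; elim: n A => [|n IH] A.
  rewrite leqn0 cards_eq0 => /eqP ->.
  by exists [::]; split; rewrite ?big_nil ?big_set0 ?mulr0.
have [->|[i0 i0A]] := set_0Vmem A.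
  by move=> _; exists [::]; split; rewrite ?big_nil ?big_set0 ?mulr0.
case: (@Order.TotalTheory.arg_maxP _ _ _ i0 (mem A) w i0A) => i iA imax cA.
have [|J [uJ sJ nJ leJ]] := IH (A :\: near i).
  rewrite -ltnS; apply: leq_trans cA; apply: proper_card.
  apply/properP; split; first exact: subsetDl.
  by exists i => //; rewrite inE nrefl.
exists (i :: J); split.
- rewrite /= uJ andbT; apply/negP => /sJ; by rewrite inE nrefl.
- by move=> j; rewrite inE => /orP[/eqP -> //|/sJ]; rewrite inE => /andP[].
- move=> a b; rewrite !inE => /orP[/eqP ->|aJ] /orP[/eqP ->|bJ] ab.
  + by rewrite eqxx in ab.
  + by have := sJ _ bJ; rewrite inE => /andP[].
  + by rewrite nsym; have := sJ _ aJ; rewrite inE => /andP[].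
  + exact: nJ.
- rewrite big_cons mulrDr (big_setID (near i)) /=; apply: lerD => //.
  apply: (@le_trans _ _ (\sum_(j in A :&: near i) w i)).
    by apply: ler_sum => j; rewrite inE => /andP[jA _]; apply: imax.
  rewrite sumr_const -[X in X <= _]mulr_natl ler_wpM2r // ler_nat.
  by apply: leq_trans (nm i); rewrite subset_leq_card // subsetIr.
Qed.

(** Each set is represented by the tuple enumerating it. Sums over tuples can then be taken one
    coordinate at a time. *)
Lemma sum_sets_le_tuples (R : realFieldType) (T : finType) k (G : seq T -> R) :
    (forall l, 0 <= G l) ->
  \sum_(S : {set T} | #|S| == k) G (enum S) <= \sum_(l : k.-tuple T) G l.
Proof.
move=> G0.
rewrite (bigID (fun l : k.-tuple T => #|[set x in l]| == k)) /=.
rewrite -[X in X <= _]addr0; apply: lerD; last by apply: sumr_ge0.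
rewrite (partition_big (fun l : k.-tuple T => [set x in l])
                       (fun S : {set T} => #|S| == k)) //=.
apply: ler_sum => S /eqP Sk.
have szS : size (enum S) == k by rewrite -cardE Sk.
rewrite (bigD1 (Tuple szS)) /=; first by rewrite lerDl sumr_ge0.
have -> : [set x in Tuple szS] = S by apply/setP => x; rewrite inE mem_enum.
by rewrite Sk !eqxx.
Qed.

Lemma big_tuple_cons (R : realFieldType) (T : finType) k (G : seq T -> R) :
  \sum_(l : k.+1.-tuple T) G l = \sum_(i : T) \sum_(l : k.-tuple T) G (i :: l).
Proof.
rewrite pair_big /=.
rewrite (reindex (fun p : T * k.-tuple T => [tuple of p.1 :: p.2])) //=.
exists (fun l : k.+1.-tuple T => (thead l, [tuple of behead l])) => [[i l] _|l _].
  by congr pair; apply: val_inj.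
by rewrite [RHS]tuple_eta.
Qed.

(** * The hypergraph of monomials and the bound on one Fourier coefficient *)

Section Hypergraph.
Variables (R : realFieldType) (T : finType).
Variables (F : {set {set T}}) (Delta d : nat).
Hypothesis readF : forall i, (#|[set A in F | i \in A]| <= Delta)%N.
Hypothesis degF : forall A, A \in F -> (#|A| <= d)%N.
Implicit Types (X A S U : {set T}) (i j : T) (J : seq T).

Local Notation Pr := (Pr R).

Definition nbhd i := i |: \bigcup_(A in F | i \in A) A.

Lemma in_nbhd i j : (j \in nbhd i) = (j == i) || [exists A in F, (i \in A) && (j \in A)].
Proof.
rewrite !inE; congr (_ || _); apply/bigcupP/exists_inP => [[A /andP[AF iA] jA]|].
  by exists A; rewrite // iA.
by case=> A AF /andP[iA jA]; exists A; rewrite // AF.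
Qed.

Lemma nbhd_sym i j : (j \in nbhd i) = (i \in nbhd j).
Proof.
rewrite !in_nbhd eq_sym; congr (_ || _).
by apply: eq_existsb => A; rewrite [(i \in A) && _]andbC.
Qed.

Lemma nbhd_refl i : i \in nbhd i.
Proof. by rewrite in_nbhd eqxx. Qed.

Lemma sub_nbhd A i : A \in F -> i \in A -> A \subset nbhd i.
Proof.
by move=> AF iA; apply: subset_trans (subsetUr _ _); apply: bigcup_sup; rewrite ?AF.
Qed.

Lemma card_nbhd i : (0 < Delta * d)%N -> (#|nbhd i| <= Delta * d)%N.
Proof.
move=> D0; rewrite /nbhd.
have [/exists_inP[A AF iA]|/exists_inPn no] := boolP [exists A in F, i \in A].
  have -> : i |: \bigcup_(A in F | i \in A) A = \bigcup_(A in F | i \in A) A.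
    by apply/setUidPr; rewrite sub1set; apply/bigcupP; exists A; rewrite ?AF.
  apply: (@leq_trans (#|[set A in F | i \in A]| * d)); last by rewrite leq_mul2r readF orbT.
  by apply: card_bigcup_le => B /andP[BF _]; apply: degF.
(* A variable in no monomial still has itself as neighbourhood, which is where positivity of
   [Delta * d] enters. *)
rewrite big_pred0 ?setU0 ?cards1 // => A.
by case: (boolP (A \in F)) => //= /no /negPf.
Qed.

(** Distance at most 2 in the graph joining variables that share a monomial. Derivatives at
    variables that are not near depend on disjoint sets of coordinates. *)
Definition near i := [set j | ~~ [disjoint nbhd i & nbhd j]].

Lemma near_refl i : i \in near i.
Proof. by rewrite inE; apply/pred0Pn; exists i; rewrite /= nbhd_refl. Qed.

Lemma near_sym i j : (j \in near i) = (i \in near j).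
Proof. by rewrite !inE disjoint_sym. Qed.

Lemma card_near i : (0 < Delta * d)%N -> (#|near i| <= (Delta * d) ^ 2)%N.
Proof.
move=> D0; apply: (@leq_trans #|\bigcup_(v in nbhd i) nbhd v|).
  apply: subset_leq_card; apply/subsetP => j; rewrite inE.
  case/pred0Pn => v /andP[/= vi vj]; apply/bigcupP; exists v => //.
  by rewrite nbhd_sym.
apply: leq_trans (card_bigcup_le (m := Delta * d) _) _ => [v _|].
  exact: card_nbhd.
rewrite leq_mul2r; apply/orP; right; apply: leq_trans (card_nbhd i D0).
by apply/eq_leq/eq_card => v; rewrite inE.
Qed.

Definition chi S X : R := (-1) ^+ #|S :&: X|.
Definition sgn X : R := (-1) ^+ (parity F X).

(** Removing [S] from the monomial makes this invariant under flips in [S]. If it fails for [i] in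
    [S], the derivative at [i] vanishes at [X]. *)
Definition covered S X i := [exists A in F, (i \in A) && (A :\: S \subset X)].
Definition alive S X := [forall i in S, covered S X i].

Lemma depends_on_subset U A : A \subset U -> depends_on U (fun X => A \subset X).
Proof.
by move=> AU X Y e; rewrite -[A \subset X]andbT -[A \subset Y]andbT -AU -!subsetI e.
Qed.

Lemma depends_on_dparity i : depends_on (nbhd i) (dparity F i).
Proof.
move=> X Y e; apply: eq_bigr => A /andP[AF iA].
apply: (@depends_on_subset (nbhd i)) => //.
exact: subset_trans (subsetDl _ _) (sub_nbhd AF iA).
Qed.

Lemma depends_on_alive S : depends_on (\bigcup_(i in S) nbhd i) (alive S).
Proof.
move=> X Y e; apply: eq_forallb => i; case: (boolP (i \in S)) => //= iS.
apply: eq_existsb => A; case: (boolP (A \in F)) => //= AF.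
case: (boolP (i \in A)) => //= iA; apply: depends_on_subset e.
apply: (subset_trans (subsetDl _ _)); apply: (subset_trans (sub_nbhd AF iA)).
exact: bigcup_sup.
Qed.

Lemma chi_flip S i X : chi S (flip i X) = if i \in S then - chi S X else chi S X.
Proof.
rewrite /chi; case: ifPn => iS; last first.
  congr (_ ^+ _); apply: eq_card => x; rewrite !inE.
  by case: eqP => [->|_]; rewrite ?(negPf iS) // addbF.
rewrite (cardsD1 i (S :&: flip i X)) (cardsD1 i (S :&: X)).
have -> : (S :&: flip i X) :\ i = (S :&: X) :\ i.
  by apply/setP => x; rewrite !inE; case: eqP; rewrite ?addbF.
rewrite !inE iS eqxx addbT /= !exprD -mulNr; congr (_ * _).
by case: (i \in X); rewrite /= ?expr0 ?expr1 ?opprK.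
Qed.

Lemma sgn_flip i X : sgn (flip i X) = if dparity F i X then - sgn X else sgn X.
Proof.
rewrite /sgn parity_flip; case: (parity F X); case: (dparity F i X);
  by rewrite /= ?expr0 ?expr1 ?opprK.
Qed.

(** Flipping an uncovered [i] in [S] negates [chi] and fixes [sgn]; flipping an influential [j] in
    [J] negates [sgn] and fixes [chi]. The surviving events live on disjoint neighbourhoods, so
    their probabilities multiply. *)
Lemma fourier_le S J :
    uniq J -> {in J &, forall i j, i != j -> j \notin near i} ->
    (forall i j, i \in S -> j \in J -> j \notin near i) ->
  `|Ex (fun X => sgn X * chi S X)| <=
    Pr (alive S) * \prod_(j <- J) (1 - Pr (dparity F j)).
Proof.
move=> uJ nJ nSJ.
have SJ i : i \in J -> i \notin S.
  by move=> iJ; apply/negP => iS; have := nSJ _ _ iS iJ; rewrite near_refl.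
have far i j : j \notin near i -> j \notin nbhd i.
  apply: contraNN => ji; rewrite inE; apply/pred0Pn; exists j.
  by rewrite /= ji nbhd_refl.
have nA i j A : j \notin near i -> A \in F -> i \in A -> j \notin A.
  by move=> /far ji AF iA; apply: contraNN ji; apply/subsetP/sub_nbhd.
pose P i X := if i \in S then ~~ covered S X i else dparity F i X.
have -> : Pr (alive S) * \prod_(j <- J) (1 - Pr (dparity F j)) =
   Pr (fun X => alive S X && all (fun j => ~~ dparity F j X) J).
  rewrite (Pr_indep_all R (@depends_on_alive S) (N := nbhd)
    (Q := fun j X => ~~ dparity F j X)) //.
  - by congr (_ * _); apply: eq_bigr => j _; rewrite PrC.
  - by move=> j X Y /depends_on_dparity ->.
  - move=> j jJ; rewrite -setI_eq0 big_distrl /=; apply/eqP/big1 => i iS.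
    by apply/eqP; rewrite setI_eq0; have := nSJ _ _ iS jJ; rewrite inE negbK.
  - by move=> i j iJ jJ ij; have := nJ _ _ iJ jJ ij; rewrite inE negbK.
apply: le_trans (le_Pr R _).
  apply: (@sign_reversing R T _ (S :|: [set j in J]) P) => [X||].
  - by rewrite /sgn /chi normrM !normrX !normrN1 !expr1n mulr1.
  (* For [i] in [S], monomials through [i] miss [J], and [covered] ignores [S]. For [i] in [J], they
     miss [S] and the rest of [J], and the derivative ignores [i] itself. *)
  - move=> i j X; rewrite !inE /P; case: ifPn => iS /=.
      move=> _ jU; congr (~~ _); apply: eq_existsb => A.
      case: (boolP (A \in F)) => //= AF; case: (boolP (i \in A)) => //= iA.
      apply: subset_flip; rewrite inE; case/orP: jU => [-> //|jJ].
      by rewrite (negPf (nA i j A (nSJ _ _ iS jJ) AF iA)) andbF.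
    move=> iJ jU; apply: eq_bigr => A /andP[AF iA]; apply: subset_flip.
    case: (eqVneq i j) => [<-|ij]; first by rewrite setD11.
    rewrite !inE negb_and negbK (eq_sym j) (negPf ij) /=.
    by apply: (nA i j) => //; case/orP: jU => [jS|jJ]; [rewrite near_sym nSJ | apply: nJ].
  - move=> i X; rewrite !inE /P chi_flip sgn_flip; case: ifPn => iS /=.
      move=> _ /exists_inPn no.
      have -> : dparity F i X = false.
        apply: big1 => A /andP[AF iA]; have := no _ AF; rewrite iA /=.
        by apply: contraNF => /(subset_trans _); apply; apply: setDS; rewrite sub1set.
      by rewrite mulrN.
    by move=> _ ->; rewrite mulNr.
move=> X /forall_inP h; apply/andP; split.
  by apply/forall_inP => i iS; have := h i; rewrite !inE iS /P iS negbK; apply.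
apply/allP => j jJ; have := h j; rewrite !inE jJ orbT /P (negPf (SJ _ jJ)).
exact.
Qed.

(** * Monomial weights: comparison with influence, and the sum of the alive probabilities *)

Definition wt : R := \sum_(A in F | A != set0) 2 ^- #|A|.

Lemma pow2V_ge0 m : 0 <= 2 ^- m :> R.
Proof. by rewrite invr_ge0 exprn_ge0. Qed.

Lemma wt_ge0 : 0 <= wt.
Proof. by apply: sumr_ge0 => A _; apply: pow2V_ge0. Qed.

(** The derivative at [i] has at most [Delta] monomials, one of them [A :\ i], so [Pr_parity_ge]
    applies to it. *)
Lemma pow2V_le_influence A i :
  A \in F -> i \in A -> 2 ^- #|A| <= Delta%:R * Pr (dparity F i).
Proof.
move=> AF iA.
have /(Pr_parity_ge R) : A :\ i \in linpart F i by apply: imset_f; rewrite inE AF.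
rewrite (eq_Pr R (parity_linpart F i)) card_linpart => h.
have h1 : 1 <= 2 ^+ #|A| * (Delta%:R * Pr (dparity F i)).
  apply: (le_trans h); rewrite -mulrA; apply: ler_pM.
  - by rewrite exprn_ge0.
  - by rewrite mulr_ge0 ?Pr_ge0.
  - by rewrite ler_eXn2l ?ltr1n // subset_leq_card // subsetDl.
  - by rewrite ler_wpM2r ?Pr_ge0 // ler_nat.
by rewrite -[X in X <= _]mul1r ler_pdivrMr ?exprn_gt0 // mulrC.
Qed.

(** Charge each monomial to its variables; a variable is charged at most [Delta] times. The empty
    monomial has no variable to charge, hence its exclusion from [wt]. *)
Lemma wt_le_influence : wt <= Delta%:R ^+ 2 * \sum_i Pr (dparity F i).
Proof.
apply: (@le_trans _ _ (\sum_(A in F) \sum_(i in A) 2 ^- #|A|)).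
  rewrite /wt big_mkcondr /=; apply: ler_sum => A AF; case: ifPn => [|_]; last first.
    by apply: sumr_ge0 => i _; apply: pow2V_ge0.
  case/set0Pn => i iA; rewrite (bigD1 i) //= lerDl.
  by apply: sumr_ge0 => j _; apply: pow2V_ge0.
rewrite (exchange_big_dep xpredT) //= mulr_sumr; apply: ler_sum => i _.
apply: (@le_trans _ _ (\sum_(A in F | i \in A) Delta%:R * Pr (dparity F i))).
  by apply: ler_sum => A /andP[]; apply: pow2V_le_influence.
rewrite sumr_const -[X in X <= _]mulr_natl expr2 -[X in _ <= X]mulrA.
apply: ler_wpM2r; first by rewrite mulr_ge0 ?Pr_ge0.
by rewrite ler_nat; apply: leq_trans (readF i); apply/eq_leq/eq_card => A; rewrite !inE.
Qed.

(** A sum over all choices of one monomial through each entry of [l]; the accumulator [U] is the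
    union of those already chosen. *)
Fixpoint cover_wt U (l : seq T) : R :=
  if l is i :: l' then \sum_(A in F | i \in A) cover_wt (U :|: A) l'
  else 2 ^- #|U|.

Lemma cover_wt_ge0 U l : 0 <= cover_wt U l.
Proof.
elim: l U => [|i l IH] U /=; first exact: pow2V_ge0.
by apply: sumr_ge0 => A _.
Qed.

(** Union bound over the choices of covering monomials. The coordinates in [S], on which nothing is
    required, cost at most [2 ^+ #|S|]. *)
Lemma Pr_covered_le S U l :
  Pr (fun X => (U :\: S \subset X) && all (covered S X) l)
    <= 2 ^+ #|S| * cover_wt U l.
Proof.
elim: l U => [|i l IH] U /=.
  rewrite (eq_Pr R (Q := fun X => U :\: S \subset X)) => [|X]; last by rewrite andbT.
  rewrite Pr_subset ler_pdivlMr ?exprn_gt0 // mulrC ler_pdivrMr ?exprn_gt0 //.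
  rewrite -exprD ler_eXn2l ?ltr1n // -(cardsID S U) leq_add2r.
  by rewrite subset_leq_card // subsetIr.
pose E A X := ((U :|: A) :\: S \subset X) && all (covered S X) l.
apply: (@le_trans _ _ (Pr (fun X => [exists A in [pred A in F | i \in A], E A X]))).
  apply: le_Pr => X /and3P[sU /exists_inP[A AF /andP[iA sA]] al].
  by apply/exists_inP; exists A; rewrite ?inE ?AF // /E setDUl subUset sU sA.
apply: (le_trans (Pr_exists_le _ _ _)); rewrite mulr_sumr.
rewrite (eq_bigl (fun A => (A \in F) && (i \in A))) => [|A]; last by rewrite inE.
by apply: ler_sum => A _; apply: IH.
Qed.

(** Monomials disjoint from [U] contribute a product. Those meeting [U] number at most
    [#|U| * Delta] and are bounded by [2 ^- #|U|]. *)
Lemma sum_pow2V_setU U :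
  \sum_(A in F | A != set0) 2 ^- #|U :|: A| <= 2 ^- #|U| * (wt + (#|U| * Delta)%:R).
Proof.
apply: (@le_trans _ _
  (\sum_(A in F | A != set0) 2 ^- #|U| * (2 ^- #|A| + #|U :&: A|%:R))).
  apply: ler_sum => A _; have [UA|UA] := posnP #|U :&: A|.
    by rewrite cardsU UA subn0 addr0 exprD invfM.
  apply: (@le_trans _ _ (2 ^- #|U|)).
    by rewrite lef_pV2 ?posrE ?exprn_gt0 // ler_eXn2l ?ltr1n // subset_leq_card // subsetUl.
  rewrite ler_peMr ?pow2V_ge0 // -[X in X <= _]add0r lerD ?pow2V_ge0 //.
  by rewrite ler1n.
rewrite -mulr_sumr big_split /= -/wt ler_wpM2l ?pow2V_ge0 // lerD2l -natr_sum ler_nat.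
apply: (@leq_trans (\sum_(A in F) \sum_(i in U | i \in A) 1)).
  rewrite big_mkcondr; apply: leq_sum => A _; case: ifP => // _.
  by rewrite sum1dep_card; apply/eq_leq/eq_card => x; rewrite !inE.
rewrite (exchange_big_dep (mem U)) /=; last by move=> A i _ /andP[].
rewrite -sum_nat_const; apply: leq_sum => i iU; rewrite iU /= sum1dep_card.
exact: readF.
Qed.

(** Exchange the choice of the first entry with that of its monomial: [A] arises from [#|A|]
    entries, at most [d], and from none if empty. *)
Lemma sum_cover_wt_cons k U :
  \sum_(l : k.+1.-tuple T) cover_wt U l <=
    d%:R * \sum_(A in F | A != set0) \sum_(l : k.-tuple T) cover_wt (U :|: A) l.
Proof.
rewrite big_tuple_cons /=.
under eq_bigr => i _ do rewrite exchange_big /=.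
rewrite (exchange_big_dep (mem F)) /=; last by move=> i A _ /andP[].
rewrite [X in _ <= _ * X]big_mkcondr mulr_sumr; apply: ler_sum => A AF.
rewrite AF /= sumr_const; case: ifPn => [_|/negPn/eqP ->].
  rewrite -[X in X <= _]mulr_natl; apply: ler_wpM2r.
    by apply: sumr_ge0 => l _; apply: cover_wt_ge0.
  by rewrite ler_nat; apply: degF.
by rewrite (_ : #|_| = 0%N) ?mulr0n ?mulr0 //; apply/eq_card0 => x; rewrite !inE.
Qed.

(** The accumulated union grows by at most [d] per step, so the single bound [m] controls the
    overlap term throughout. *)
Lemma sum_cover_wt_le (m k : nat) U : ((#|U| + k * d) * Delta <= m)%N ->
  \sum_(l : k.-tuple T) cover_wt U l <= (d%:R * (wt + m%:R)) ^+ k * 2 ^- #|U|.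
Proof.
elim: k U => [|k IH] U hU.
  rewrite expr0 mul1r (big_pred1 [tuple]) // => l.
  by apply/esym/eqP; apply: tuple0.
apply: (le_trans (sum_cover_wt_cons _ _)).
rewrite exprS -!mulrA; apply: ler_wpM2l; first exact: ler0n.
set c := (_ ^+ k).
have c0 : 0 <= c by rewrite exprn_ge0 // mulr_ge0 // addr_ge0 ?wt_ge0.
apply: (@le_trans _ _ (\sum_(A in F | A != set0) c * 2 ^- #|U :|: A|)).
  apply: ler_sum => A /andP[AF _]; apply: IH.
  apply: leq_trans hU; rewrite leq_mul2r mulSn addnA leq_add2r; apply/orP; right.
  by apply: leq_trans (leq_card_setU _ _) _; rewrite leq_add2l degF.
rewrite -mulr_sumr mulrCA; apply: ler_wpM2l => //.
apply: (le_trans (sum_pow2V_setU U)); rewrite mulrC; apply: ler_wpM2r.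
  exact: pow2V_ge0.
rewrite lerD2l ler_nat; apply: leq_trans hU; rewrite leq_mul2r leq_addr orbT //.
Qed.

(** The first monomial is treated apart: starting from the empty union there is no overlap term,
    which leaves a bare factor [wt]. This factor later yields [Pr (parity F)]. *)
Lemma sum_Pr_alive_le k :
  \sum_(S : {set T} | #|S| == k.+1) Pr (alive S) <=
    (2 * d%:R) ^+ k.+1 * wt * (wt + (k.+1 * (Delta * d))%:R) ^+ k.
Proof.
apply: (@le_trans _ _ (\sum_(S : {set T} | #|S| == k.+1) 2 ^+ k.+1 * cover_wt set0 (enum S))).
  apply: ler_sum => S /eqP Sk; rewrite -Sk.
  apply: le_trans (Pr_covered_le S set0 (enum S)); apply: le_Pr => X /forall_inP h.
  rewrite set0D sub0set; apply/allP => i; rewrite mem_enum; exact: h.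
rewrite -mulr_sumr exprMn -!mulrA; apply: ler_wpM2l; first by rewrite exprn_ge0.
apply: (le_trans (sum_sets_le_tuples _ _)); first exact: cover_wt_ge0.
apply: (le_trans (sum_cover_wt_cons _ _)).
rewrite exprS -!mulrA; apply: ler_wpM2l; first exact: ler0n.
set m := (k.+1 * _)%N.
rewrite mulrCA /wt mulr_suml; apply: ler_sum => A /andP[AF _].
rewrite set0U mulrC -exprMn; apply: sum_cover_wt_le.
rewrite /m mulSn mulnDl (mulnC Delta d) -mulnA leq_add2r leq_mul2r degF // orbT //.
Qed.

End Hypergraph.

(** * Elementary inequalities replacing the exponential *)

Lemma bernoulli_le (R : realFieldType) (t : R) k :
  0 <= t <= 1 -> 1 - k%:R * t <= (1 - t) ^+ k.
Proof.
case/andP=> t0 t1; elim: k => [|k IH]; first by rewrite mul0r subr0.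
rewrite exprS -natr1.
have := ler_wpM2l (x := 1 - t) _ IH; rewrite subr_ge0 => /(_ t1) h.
apply: le_trans h; have k0 : 0 <= k%:R :> R by [].
nra.
Qed.

(** With t = w / (k+1), Bernoulli bounds 1 - w by (1 - t)^(k+1), and (1 - t)(1 + t) is at most 1. *)
Lemma one_sub_mul_expr_le (R : realFieldType) (w : R) k :
  0 <= w <= 1 -> (1 - w) * (1 + w / k.+1%:R) ^+ k.+1 <= 1.
Proof.
case/andP=> w0 w1; set t := w / _.
have k0 : 0 < k.+1%:R :> R by rewrite ltr0n.
have t0 : 0 <= t by rewrite divr_ge0.
have t1 : t <= 1.
  by rewrite ler_pdivrMr // mul1r (le_trans w1) // ler1n.
have -> : w = k.+1%:R * t by rewrite /t mulrC divfK // gt_eqF.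
apply: (@le_trans _ _ ((1 - t) ^+ k.+1 * (1 + t) ^+ k.+1)).
  by rewrite ler_wpM2r ?exprn_ge0 ?addr_ge0 // bernoulli_le ?t0.
rewrite -exprMn exprn_ile1 //; nra.
Qed.

(* An [exp]-free form of [\prod (1 - w_j) <= exp (- s) <= (1 + s / k) ^- k]. *)
Lemma prod_one_sub_le (R : realFieldType) (T : Type) (w : T -> R) (J : seq T) k :
    (forall j, 0 <= w j <= 1) ->
  (\prod_(j <- J) (1 - w j)) * (1 + (\sum_(j <- J) w j) / k.+1%:R) ^+ k.+1 <= 1.
Proof.
move=> w01; elim: J => [|j J IH].
  by rewrite !big_nil mul0r addr0 expr1n mulr1.
rewrite !big_cons; set p := \prod_(_ <- _) _ in IH *; set s := \sum_(_ <- _) _ in IH *.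
have p0 : 0 <= p by apply: prodr_ge0 => i _; rewrite subr_ge0; case/andP: (w01 i).
have s0 : 0 <= s by apply: sumr_ge0 => i _; case/andP: (w01 i).
have /andP[w0 w1] := w01 j.
have k0 : 0 < k.+1%:R :> R by rewrite ltr0n.
apply: le_trans (mulr_ile1 _ _ (one_sub_mul_expr_le k (w01 j)) IH); last first.
- by rewrite mulr_ge0 // exprn_ge0 // addr_ge0 // divr_ge0 // ltW.
- by rewrite mulr_ge0 ?subr_ge0 // exprn_ge0 // addr_ge0 // divr_ge0 // ltW.
rewrite mulrACA -exprMn; apply: ler_wpM2l; first by rewrite mulr_ge0 // subr_ge0.
rewrite lerXn2r ?nnegrE ?mulr_ge0 ?addr_ge0 ?divr_ge0 ?addr_ge0 ?(ltW k0) //.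
rewrite [(w j + s) / _]mulrDl.
have : 0 <= (w j / k.+1%:R) * (s / k.+1%:R).
  by rewrite !mulr_ge0 ?invr_ge0 // ltW.
by move: (w j / _) (s / _) => a b; nra.
Qed.

(** * Decay against growth: the level bound for the sign function *)

Section Growth.
Variables (R : realFieldType) (T : finType).
Variables (F : {set {set T}}) (Delta d : nat).
Hypothesis readF : forall i, (#|[set A in F | i \in A]| <= Delta)%N.
Hypothesis degF : forall A, A \in F -> (#|A| <= d)%N.

Local Notation Pr := (Pr R).
Local Notation D := (Delta * d)%N.

Definition fcoef (S : {set T}) : R := Ex (fun X => sgn R F X * chi R S X).
Definition influence : R := \sum_i Pr (dparity F i).

Lemma influence_ge0 : 0 <= influence.
Proof. by apply: sumr_ge0 => i _; apply: Pr_ge0. Qed.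

(** Here [s] is the total influence of a greedy [J] chosen away from [S]. The variables near [S]
    number at most [D ^ 2 * #|S|], each of influence at most 1, whence the extra [#|S|]. *)
Lemma fcoef_decay (S : {set T}) k : (0 < D)%N ->
  exists s : R, [/\ 0 <= s, influence <= D%:R ^+ 2 * (s + #|S|%:R)
    & `|fcoef S| * (1 + s / k.+1%:R) ^+ k.+1 <= Pr (alive F S)].
Proof.
move=> D0; pose far := ~: \bigcup_(i in S) near F i.
pose w i := Pr (dparity F i).
have w01 i : 0 <= w i <= 1 by rewrite Pr_ge0 Pr_le1.
have [J [uJ sJ nJ leJ]] := sparse_subfamily far (@near_refl _ F) (@near_sym _ F)
  (fun i => card_near readF degF i D0) (w := w) (fun i => Pr_ge0 _ _).
exists (\sum_(j <- J) w j); split.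
- by apply: sumr_ge0 => j _; apply: Pr_ge0.
- rewrite /influence (bigID (mem far)) /= mulrDr -natrX; apply: lerD => //.
  apply: (@le_trans _ _ (\sum_(i in \bigcup_(i in S) near F i) 1)).
    rewrite (eq_bigl (mem (\bigcup_(i in S) near F i))) => [|i]; last first.
      by rewrite /= /far inE negbK.
    by apply: ler_sum => i _; apply: Pr_le1.
  rewrite sumr_const -natrM ler_nat mulnC.
  apply: leq_trans (card_bigcup_le (m := (D ^ 2)%N) _) _ => [i _|].
    exact: card_near.
  by rewrite leq_mul2r; apply/orP; right; apply/eq_leq/eq_card => i; rewrite inE.
have SJ i j : i \in S -> j \in J -> j \notin near F i.
  move=> iS /sJ; rewrite inE; apply: contraNN => ji.
  by apply/bigcupP; exists i.
have := fourier_le R uJ nJ SJ => h.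
have s0 : 0 <= \sum_(j <- J) w j by apply: sumr_ge0 => j _; apply: Pr_ge0.
apply: (@le_trans _ _ (Pr (alive F S) * (\prod_(j <- J) (1 - w j)) *
   (1 + (\sum_(j <- J) w j) / k.+1%:R) ^+ k.+1)).
  by rewrite ler_wpM2r // exprn_ge0 // addr_ge0 // divr_ge0.
by rewrite -mulrA ler_piMr ?Pr_ge0 // prod_one_sub_le.
Qed.

Lemma influence_le_Pr : (0 < D)%N ->
  influence / D%:R ^+ 2 <= 2 * Pr (parity F) * (1 + influence / D%:R ^+ 2).
Proof.
move=> D0; have [s [s0]] := fcoef_decay set0 0 D0.
rewrite cards0 addr0 expr1 divr1 => hs.
have -> : fcoef set0 = 1 - 2 * Pr (parity F).
  rewrite -ExZ; apply/eqP; rewrite eq_sym subr_eq -ExD -[X in X == _](Ex_const T).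
  apply/eqP/eq_Ex => X; rewrite /chi set0I cards0 expr0 mulr1 /sgn.
  by case: (parity F X) => /=; ring.
move=> h; have := le_trans h (Pr_le1 R _) => {}h.
have h' : (1 - 2 * Pr (parity F)) * (1 + s) <= 1.
  by apply: le_trans h; rewrite ler_wpM2r ?addr_ge0 // ler_norm.
have u0 := influence_ge0.
have DD : 0 < D%:R ^+ 2 :> R by rewrite exprn_gt0 // ltr0n.
have us : influence / D%:R ^+ 2 <= s by rewrite ler_pdivrMr // mulrC.
have uu : 0 <= influence / D%:R ^+ 2 by rewrite divr_ge0 // ltW.
have m0 := Pr_ge0 R (parity F).
move: (_ / _) (Pr _) us uu m0 h' => u mu us uu m0 h'.
(* If 1 - 2 mu is nonnegative, [s] may be lowered to [u] in [h']; otherwise 2 mu > 1 and the bound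
   is immediate. *)
have [m1|m1] := lerP (2 * mu) 1; first by nra.
nra.
Qed.

(** The case of empty [J], which also serves when [D] is zero. *)
Lemma fcoef_le_alive S : `|fcoef S| <= Pr (alive F S).
Proof.
have := @fourier_le R T F S [::]; rewrite big_nil mulr1; exact.
Qed.

Lemma level_le k :
  \sum_(S : {set T} | #|S| == k.+1) `|fcoef S| <=
    2 * Pr (parity F) * (4 * k.+1%:R) ^+ k.+1 * (D%:R ^+ 4) ^+ k.+1.
Proof.
have alive_le := sum_Pr_alive_le R readF degF k.
(* If [D = 0], either [Delta = 0] and [wt] vanishes, or [d = 0] and the power of [2 * d] does. *)
have [D0|D0] := posnP D.
  rewrite D0 expr0n /= expr0n /= mulr0.
  apply: (@le_trans _ _ (\sum_(S : {set T} | #|S| == k.+1) Pr (alive F S))).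
    by apply: ler_sum => S _; apply: fcoef_le_alive.
  apply: (le_trans alive_le); move/eqP: D0; rewrite muln_eq0 => /orP[] /eqP z.
    have := wt_le_influence R readF; rewrite z expr0n mul0r => w0.
    have -> : wt R F = 0 by apply/eqP; rewrite eq_le w0 wt_ge0.
    by rewrite mulr0 mul0r.
  by rewrite z mulr0 expr0n /= !mul0r.
set L := \sum_(S | _) _; set u := influence / D%:R ^+ 2.
have DD : 0 < D%:R ^+ 2 :> R by rewrite exprn_gt0 // ltr0n.
have k0 : 0 < k.+1%:R :> R by rewrite ltr0n.
have kN0 : k.+1%:R != 0 :> R by rewrite pnatr_eq0.
have u0 : 0 <= u by rewrite divr_ge0 ?influence_ge0 // ltW.
set q := 1 + u / k.+1%:R.
have q1 : 1 <= q by rewrite lerDl divr_ge0 // ltW.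
have q0 : 0 < q by rewrite (lt_le_trans ltr01).
have kq : k.+1%:R * q = k.+1%:R + u by rewrite mulrDr mulr1 [X in _ + X]mulrC divfK.
(* From u <= s + (k+1) follows q <= 2 (1 + s / (k+1)), the source of [2 ^+ k.+1]. *)
have L1 : L * q ^+ k.+1 <= 2 ^+ k.+1 * \sum_(S : {set T} | #|S| == k.+1) Pr (alive F S).
  rewrite mulr_suml mulr_sumr; apply: ler_sum => S /eqP Sk.
  have [s [s0 hs h]] := fcoef_decay S k D0.
  apply: (@le_trans _ _ (2 ^+ k.+1 * (`|fcoef S| * (1 + s / k.+1%:R) ^+ k.+1))); last first.
    by rewrite ler_wpM2l // exprn_ge0.
  rewrite mulrCA ler_wpM2l // -exprMn lerXn2r ?nnegrE ?(ltW q0) //.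
    by rewrite mulr_ge0 // addr_ge0 // divr_ge0 // ltW.
  have : u / k.+1%:R <= s / k.+1%:R + 1.
    rewrite -[X in _ + X](divff kN0) -mulrDl.
    by rewrite ler_pM2r ?invr_gt0 // ler_pdivrMr // mulrC -Sk.
  have : 0 <= s / k.+1%:R by rewrite divr_ge0 // ltW.
  by rewrite /q; move: (u / _) (s / _) => a b; lra.
pose M : R := Delta%:R ^+ 2 * D%:R ^+ 2.
have M0 : 0 <= M by rewrite mulr_ge0 ?exprn_ge0.
have D1 : 1 <= D%:R :> R by rewrite ler1n.
have De1 : 1 <= Delta%:R :> R by rewrite ler1n; case: (Delta) D0.
have d0 : 0 <= d%:R :> R by [].
have V1 : wt R F <= M * u.
  have -> : M * u = Delta%:R ^+ 2 * influence.
    by rewrite /M /u -mulrA [D%:R ^+ 2 * _]mulrC divfK // gt_eqF.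
  exact: wt_le_influence.
have V2 : wt R F + (k.+1 * D)%:R <= M * k.+1%:R * q.
  have -> : M * k.+1%:R * q = M * u + k.+1%:R * M.
    by rewrite -mulrA kq mulrDr addrC (mulrC M k.+1%:R).
  apply: lerD => //; rewrite natrM ler_wpM2l // /M.
  have := ler_wpM2l (ltW DD) (_ : 1 <= Delta%:R ^+ 2).
  rewrite exprn_ege1 // => /(_ isT); rewrite mulr1 [_ * Delta%:R ^+ 2]mulrC.
  by apply: le_trans; rewrite expr2 ler_peMr.
have V0 := wt_ge0 R F.
have L2 : L * q ^+ k.+1 <=
    2 ^+ k.+1 * ((2 * d%:R) ^+ k.+1 * (M * u) * (M * k.+1%:R * q) ^+ k).
  apply: (le_trans L1); rewrite ler_wpM2l ?exprn_ge0 //; apply: (le_trans alive_le).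
  apply: ler_pM.
  - by rewrite mulr_ge0 // exprn_ge0 // mulr_ge0.
  - by rewrite exprn_ge0 // addr_ge0.
  - by rewrite ler_wpM2l // exprn_ge0 // mulr_ge0.
  - by rewrite lerXn2r ?nnegrE ?addr_ge0 // !mulr_ge0 // ltW.
(* The growth q^k cancels against the decay q^(k+1), leaving one factor [q] and the factor [u] from
   [wt]. *)
have L3 : L * q <= 4 ^+ k.+1 * d%:R ^+ k.+1 * M ^+ k.+1 * k.+1%:R ^+ k * u.
  rewrite -(ler_pM2r (exprn_gt0 k q0)) -[X in X <= _]mulrA -exprS; apply: (le_trans L2).
  rewrite le_eqVlt; apply/orP; left; apply/eqP.
  have -> : (4 : R) = 2 * 2 by rewrite -natrM.
  by move: (M) => M'; rewrite !exprMn !exprS; ring.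
(* This turns [u] into [Pr (parity F)] at the price of one [q], exactly the one left over. *)
have umu : u <= 2 * Pr (parity F) * (k.+1%:R * q).
  apply: le_trans (influence_le_Pr D0) _; rewrite -/u.
  apply: ler_wpM2l; first by rewrite mulr_ge0 ?Pr_ge0.
  by rewrite kq lerD2r ler1n.
rewrite -(ler_pM2r q0); apply: (le_trans L3).
set c := 4 ^+ _ * _ * _ * _.
have c0 : 0 <= c by rewrite !mulr_ge0 ?exprn_ge0.
apply: (le_trans (ler_wpM2l c0 umu)).
have -> : c * (2 * Pr (parity F) * (k.+1%:R * q)) =
   (2 * Pr (parity F) * (4 * k.+1%:R) ^+ k.+1) * (d%:R * M) ^+ k.+1 * q.
  by rewrite /c; move: (M) => M'; rewrite !exprMn !exprS; ring.
apply: ler_wpM2r; first exact: ltW.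
apply: ler_wpM2l.
  apply: mulr_ge0; first by apply: mulr_ge0 => //; apply: Pr_ge0.
  by apply/exprn_ge0/mulr_ge0.
(* It remains to see that d Delta^2 D^2 <= D^4, which holds since d <= d^2. *)
rewrite lerXn2r ?nnegrE ?mulr_ge0 ?exprn_ge0 //.
rewrite /M -!natrX -!natrM ler_nat.
have -> : (D ^ 4 = D ^ 2 * D ^ 2)%N by rewrite -expnD.
rewrite mulnA leq_mul2r; apply/orP; right.
rewrite expnMn (mulnC d) leq_mul2l -(mulnn d) leq_pmulr ?orbT //.
by case: (d) D0; rewrite ?muln0.
Qed.

End Growth.

(** * Translation from [mpoly] and the cube to set families *)

Section Translation.
Variables (R : realType) (n : nat).
Implicit Types (p : {mpoly 'F_2[n]}) (X S : {set 'I_n}).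

Definition cube_of_set X : cube n := [ffun i => i \in X].

Lemma cube_of_set_bij : bijective cube_of_set.
Proof.
exists (fun x : cube n => [set i | x i]) => [X|x].
  by apply/setP => i; rewrite inE ffunE.
by apply/ffunP => i; rewrite ffunE inE.
Qed.

Lemma card_cube : #|{: cube n}|%:R = 2 ^+ #|'I_n| :> R.
Proof. by rewrite card_ffun card_bool natrX. Qed.

Lemma expect_Ex (g : cube n -> R) : expect g = Ex (fun X => g (cube_of_set X)).
Proof.
rewrite /expect /Ex card_cube (reindex cube_of_set) //.
exact: onW_bij cube_of_set_bij.
Qed.

Lemma prob_Pr (E : pred (cube n)) : prob R E = Pr R (fun X => E (cube_of_set X)).
Proof.
rewrite /Pr -[RHS](expect_Ex (fun x => (E x)%:R)) /prob /expect -natr_sum -sum1dep_card.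
by rewrite big_mkcond; congr (_%:R / _); apply: eq_bigr => x _; case: (E x).
Qed.

(** A multilinear monomial is determined by its support, and nonzero coefficients in ['F_2] are 1,
    so for multilinear [p] this family encodes [p] faithfully. *)
Definition monomials p : {set {set 'I_n}} :=
  [set A | A \in [seq [set i | m i != 0%N] | m : 'X_{1..n} <- msupp p]].

Lemma support_inj p : multilinear p ->
  {in msupp p &, injective (fun m : 'X_{1..n} => [set i | m i != 0%N])}.
Proof.
move=> ml m m' mp mp' /setP e; apply/mnmP => i.
move: (e i) (ml _ mp i) (ml _ mp' i); rewrite !inE.
by case: (m i) => [|[|?]]; case: (m' i) => [|[|?]].
Qed.

Lemma perm_monomials p : multilinear p ->
  perm_eq (enum (monomials p)) [seq [set i | m i != 0%N] | m : 'X_{1..n} <- msupp p].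
Proof.
move=> ml; apply: uniq_perm; first exact: enum_uniq.
  by rewrite map_inj_in_uniq ?msupp_uniq //; apply: support_inj.
by move=> A; rewrite mem_enum inE.
Qed.

Lemma monomials_read p Delta : multilinear p -> read_le Delta p ->
  forall i, (#|[set A in monomials p | i \in A]| <= Delta)%N.
Proof.
move=> ml rd i; apply: leq_trans (rd i).
rewrite -sum1dep_card big_mkcondr -big_enum /= (perm_big _ (perm_monomials ml)) /=.
rewrite big_map -big_mkcond /= sum1_count.
by apply/eq_leq/eq_count => m; rewrite inE.
Qed.

Lemma monomials_degree p :
  forall A, A \in monomials p -> (#|A| <= degree p)%N.
Proof.
move=> A; rewrite inE => /mapP[m mp ->].
apply: (@leq_trans (mdeg m)); last first.
  by rewrite /degree -ltnS; have := msize_mdeg_lt mp; case: (msize p).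
rewrite mdegE -sum1dep_card big_mkcond /=; apply: leq_sum => i _.
by case: (m i).
Qed.

Lemma boolfun_parity p X : multilinear p ->
  boolfun p (cube_of_set X) = parity (monomials p) X.
Proof.
move=> ml; rewrite /boolfun.
have F20 : false%:R = 0 :> 'F_2 by [].
have F2E (b c : bool) : (b (+) c)%:R = b%:R + c%:R :> 'F_2.
  by case: b; case: c; apply/val_inj.
have -> : p.@[fun i => (cube_of_set X i)%:R] = (parity (monomials p) X)%:R.
  rewrite mevalE /parity (big_morph (fun b : bool => b%:R : 'F_2) F2E F20).
  rewrite -big_enum /= (perm_big _ (perm_monomials ml)) /= [RHS]big_map [LHS]big_seq [RHS]big_seq.
  apply: eq_bigr => m mp.
  have -> : p@_m = 1.
    move: mp; rewrite mcoeff_msupp; case: (p@_m) => [[|[|a]] ha] //= _.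
    exact/val_inj.
  rewrite mul1r; case: subsetP => [sX|nX].
    apply: big1 => i _; rewrite ffunE; case: (eqVneq (m i) 0%N) => [->|mi].
      by rewrite expr0.
    by rewrite sX ?inE // expr1n.
  have [i /andP[mi iX]] : exists i, (m i != 0%N) && (i \notin X).
    apply/existsP; apply: contra_notT nX => /existsPn h i; rewrite inE => mi.
    by have := h i; rewrite mi /= negbK.
  by rewrite (bigD1 i) //= ffunE (negPf iX) expr0n (negPf mi) mul0r.
by case: (parity _ _).
Qed.

Lemma Ex_chi S : S != set0 -> Ex (chi R S) = 0.
Proof.
case/set0Pn => i iS.
have : Ex (chi R S) = - Ex (chi R S).
  rewrite {1}/Ex (reindex_inj (inv_inj (@flipK _ i))) /= -mulN1r -ExZ.
  by congr (_ / _); apply: eq_bigr => X _; rewrite chi_flip iS mulN1r.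
by move/eqP; rewrite -addr_eq0 -mulr2n mulrn_eq0 => /eqP.
Qed.

(** As p = (1 - (-1)^p) / 2, only the sign part contributes: a nontrivial character has mean
    zero. *)
Lemma fourier_fcoef p S : multilinear p -> S != set0 ->
  fourier R (boolfun p) S = - fcoef R (monomials p) S / 2.
Proof.
move=> ml S0; rewrite /fourier expect_Ex.
have -> : - fcoef R (monomials p) S / 2 =
    2^-1 * Ex (chi R S) + (- 2^-1) * fcoef R (monomials p) S.
  by rewrite Ex_chi // mulr0 add0r mulNr mulrC mulNr.
rewrite -!ExZ -ExD; apply: eq_Ex => X; rewrite boolfun_parity //.
have -> : (\sum_(i in S) cube_of_set X i)%N = #|S :&: X|.
  rewrite -sum1_card [RHS](eq_bigl (fun i => (i \in S) && (i \in X))) => [|i]; last by rewrite inE.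
  by rewrite [RHS]big_mkcondr; apply: eq_bigr => i _; rewrite ffunE; case: (i \in X).
rewrite -/(chi R S X) /sgn; case: (parity _ _) => /=; rewrite ?expr0 ?expr1.
  by field.
by ring.
Qed.

End Translation.

Theorem theorem1p10 (R : realType) :
  exists C : R, 0 < C /\
    forall (n Delta d : nat) (p : {mpoly 'F_2[n]}),
      multilinear p -> read_le Delta p -> degree p = d ->
      forall k : nat, (1 <= k <= n)%N ->
        L1 R k (boolfun p) <=
          prob R (boolfun p) * (C * k%:R) ^+ k * (Delta * d)%:R ^+ (8 * k).
Proof.
(* The constant 4 is that of [level_le], whose extra factor 2 is absorbed by the 1/2 of
   [fourier_fcoef]. *)
exists 4; split=> // n Delta d p ml rd dd [//|k] _.
have degF A : A \in monomials p -> (#|A| <= d)%N.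
  by rewrite -dd; apply: monomials_degree.
have main := level_le R (monomials_read ml rd) degF k.
have -> : L1 R k.+1 (boolfun p) =
    (\sum_(S : {set 'I_n} | #|S| == k.+1) `|fcoef R (monomials p) S|) / 2.
  rewrite mulr_suml; apply: eq_bigr => S /eqP Sk.
  rewrite fourier_fcoef //; last by rewrite -card_gt0 Sk.
  by rewrite normrM normrN normfV normr_nat.
have -> : prob R (boolfun p) = Pr R (parity (monomials p)).
  by rewrite prob_Pr; apply: eq_Pr => X; apply: boolfun_parity.
rewrite ler_pdivrMr //; apply: (le_trans main).
move: (Pr _ _) (Pr_ge0 R (parity (monomials p))) => mu mu0.
rewrite [X in _ <= X]mulrC !mulrA; apply: ler_wpM2l.
  by apply: mulr_ge0; [exact: mulr_ge0 | apply/exprn_ge0/mulr_ge0].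
(* The exponent obtained is 4(k+1), weakened to 8(k+1); both powers vanish when [Delta * d] is
   zero. *)
rewrite -exprM -!natrX ler_nat.
have [->|D0] := posnP (Delta * d)%N; first by rewrite !exp0n.
by rewrite leq_pexp2l // leq_mul2r orbT.
Qed.
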